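(* Consider a solution candidate of negative hyperbolic form, i.e. functions $w_i=w_i(t)$, $x_i=x_i(t)$, $y_i=\rho_i(t)\sinh[\beta(t)+b_i]$, $z_i=\rho_i(t)\cosh[\beta(t)+b_i]$, $i=1,\dots,N$, with $b_i$ constants, $\beta$ nonconstant, $z_i\ge1$ and $w_i^2+x_i^2-\rho_i^2=-1$. It is a negative hyperbolic rotopulsator of the curved $N$-body problem in $\mathbb H^3$ if and only if $$\dot\beta=\frac{c}{\sum_{j=1}^Nm_j\rho_j^2},$$ where $c\ne0$ is a constant, there are at least two distinct indices $i,j$ such that $q_{ij}$ is not constant, and the variables $w_i,x_i,\rho_i$, $i=1,\dots,N$, satisfy the first-order system of $5N$ equations (with the $N$ constraints $w_i^2+x_i^2=\rho_i^2-1$) $$\begin{cases}\dot w_i=p_i\\ \dot x_i=s_i\\ \dot p_i=\sum_{j\ne i}\frac{m_j(w_j+q_{ij}w_i)}{(q_{ij}^2-1)^{3/2}}+K_i(\mathbf w,\mathbf x,p_i,s_i)\,w_i\\ \dot s_i=\sum_{j\ne i}\frac{m_j(x_j+q_{ij}x_i)}{(q_{ij}^2-1)^{3/2}}+K_i(\mathbf w,\mathbf x,p_i,s_i)\,x_i\\ \rho_i\ddot\beta+2\dot\rho_i\dot\beta=\sum_{j\ne i}\frac{m_j\rho_j\sinh(b_j-b_i)}{(q_{ij}^2-1)^{3/2}},\end{cases}$$ $i=1,\dots,N$, where $\mathbf w=(w_1,\dots,w_N)$, $\mathbf x=(x_1,\dots,x_N)$, $$K_i(\mathbf w,\mathbf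 x,p_i,s_i):=\frac{(w_is_i-x_ip_i)^2+p_i^2+s_i^2}{w_i^2+x_i^2+1}+\frac{c^2(w_i^2+x_i^2+1)}{[\sum_{j=1}^Nm_j(w_j^2+x_j^2+1)]^2},$$ and, for any $i,j$, $q_{ij}=w_iw_j+x_ix_j-(w_i^2+x_i^2+1)^{1/2}(w_j^2+x_j^2+1)^{1/2}\cosh(b_i-b_j)$. If (the other conditions holding) the quantities $q_{ij}$ are constant for all distinct $i,j$, then the solution is a negative hyperbolic relative equilibrium. If $q_{ij}=\pm1$ for some distinct $i,j$, then such solutions do not exist.
   Context: Masses $m_1,\dots,m_N>0$, $N\ge2$; dots denote $d/dt$; $\sum_{j\ne i}$ runs over $j\in\{1,\dots,N\}\setminus\{i\}$. $\mathbb H^3=\{(w,x,y,z): w^2+x^2+y^2-z^2=-1,\ z>0\}$ in Minkowski space $\mathbb R^{3,1}$, $\cdot$ is the Lorentz inner product of signature $(+,+,+,-)$, $\mathbf q_i=(w_i,x_i,y_i,z_i)$, $q_{ij}:=\mathbf q_i\cdot\mathbf q_j$, $\dot q_{ii}:=\dot{\mathbf q}_i\cdot\dot{\mathbf q}_i$. The curved $N$-body problem in $\mathbb H^3$ is the system $$\ddot{\mathbf q}_i=\sum_{j\ne i}\frac{m_j(\mathbf q_j+q_{ij}\mathbf q_i)}{(q_{ij}^2-1)^{3/2}}+\dot q_{ii}\mathbf q_i,\quad q_{ii}=-1,\quad i=1,\dots,N.$$ A negative hyperbolic rotopulsator is a solution of this system of the negative hyperbolic form described in the claim for which there are at least two indices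 $i\ne j$ with $q_{ij}$ not constant; if instead all $q_{ij}$, $i\ne j$, are constant, the solution is called a negative hyperbolic relative equilibrium. *)

(* Defs.v *)
From HB Require Import structures.
From mathcomp Require Import all_boot all_order all_algebra.
From mathcomp Require Import all_classical all_reals all_analysis.

Set Implicit Arguments.
Unset Strict Implicit.
Unset Printing Implicit Defensive.

Import Order.TTheory GRing.Theory Num.Theory.
Import numFieldNormedType.Exports.

Local Open Scope ring_scope.
Local Open Scope classical_set_scope.

Definition sinh (R : realType) (x : R) : R := (expR x - expR (- x)) / 2.

Definition cosh (R : realType) (x : R) : R := (expR x + expR (- x)) / 2.

Definition constant_on (R : realType) (I : set R) (f : R -> R) : Prop :=
  forall s t : R, I s -> I t -> f s = f t.

(* The Minkowski space R^{3,1} is 'rV[R]_4 with coordinates (w, x, y, z). *)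
Definition vec4 (R : realType) (w x y z : R) : 'rV[R]_4 :=
  \row_(k < 4) [:: w; x; y; z]`_k.

Definition lorentz (R : realType) (u v : 'rV[R]_4) : R :=
  u 0 0 * v 0 0 + u 0 1 * v 0 1 + u 0 2 * v 0 2 - u 0 3 * v 0 3.

Definition in_H3 (R : realType) (u : 'rV[R]_4) : Prop :=
  lorentz u u = -1 /\ 0 < u 0 3.

(* [I] is the time interval, and motions are only constrained on [I].  Since
   x / 0 = 0 here, a solution is explicitly required to stay where the right-hand
   side (q_ij^2 - 1)^(-3/2) makes sense, i.e. where q_ij^2 - 1 > 0 for j <> i.
   On H^3 one has q_ij <= -1, so this excludes exactly q_ij = -1. *)
Definition curved_nbody_solution (R : realType) (N : nat) (m : 'I_N -> R)
    (I : set R) (q : 'I_N -> R -> 'rV[R]_4) : Prop :=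
  forall t : R, I t -> forall i : 'I_N,
  [/\ in_H3 (q i t),
      forall j : 'I_N, j != i -> 0 < lorentz (q i t) (q j t) ^+ 2 - 1,
      derivable (q i) t 1 &
      is_derive t 1 (q i)^`()
        (\sum_(j < N | j != i)
            (m j / (lorentz (q i t) (q j t) ^+ 2 - 1) `^ (3 / 2)) *:
            (q j t + lorentz (q i t) (q j t) *: q i t)
         + lorentz ((q i)^`()%classic t) ((q i)^`()%classic t) *: q i t)].

Definition nh_motion (R : realType) (N : nat) (w x rho : 'I_N -> R -> R)
    (b : 'I_N -> R) (beta : R -> R) (i : 'I_N) (t : R) : 'rV[R]_4 :=
  vec4 (w i t) (x i t)
       (rho i t * sinh (beta t + b i)) (rho i t * cosh (beta t + b i)).

Definition negative_hyperbolic_form (R : realType) (N : nat) (I : set R)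
    (w x rho : 'I_N -> R -> R) (b : 'I_N -> R) (beta : R -> R) : Prop :=
  ~ constant_on I beta /\
  forall t : R, I t -> forall i : 'I_N,
    1 <= rho i t * cosh (beta t + b i) /\
    w i t ^+ 2 + x i t ^+ 2 - rho i t ^+ 2 = -1.

Definition negative_hyperbolic_solution (R : realType) (N : nat)
    (m : 'I_N -> R) (I : set R) (q : 'I_N -> R -> 'rV[R]_4) : Prop :=
  curved_nbody_solution m I q /\
  exists (w x rho : 'I_N -> R -> R) (b : 'I_N -> R) (beta : R -> R),
    negative_hyperbolic_form I w x rho b beta /\
    forall t : R, I t -> forall i : 'I_N, q i t = nh_motion w x rho b beta i t.

Definition negative_hyperbolic_rotopulsator (R : realType) (N : nat)
    (m : 'I_N -> R) (I : set R) (q : 'I_N -> R -> 'rV[R]_4) : Prop :=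
  negative_hyperbolic_solution m I q /\
  exists i j : 'I_N,
    i != j /\ ~ constant_on I (fun t : R => lorentz (q i t) (q j t)).

Definition negative_hyperbolic_relative_equilibrium (R : realType) (N : nat)
    (m : 'I_N -> R) (I : set R) (q : 'I_N -> R -> 'rV[R]_4) : Prop :=
  negative_hyperbolic_solution m I q /\
  forall i j : 'I_N,
    i != j -> constant_on I (fun t : R => lorentz (q i t) (q j t)).

(* q_ij in terms of the values w, x of the first two coordinates. *)
Definition nh_q (R : realType) (N : nat) (b w x : 'I_N -> R) (i j : 'I_N) : R :=
  w i * w j + x i * x j
  - Num.sqrt (w i ^+ 2 + x i ^+ 2 + 1) * Num.sqrt (w j ^+ 2 + x j ^+ 2 + 1)
    * cosh (b i - b j).

Definition nh_K (R : realType) (N : nat) (m : 'I_N -> R) (c : R)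
    (w x : 'I_N -> R) (i : 'I_N) (p s : R) : R :=
  ((w i * s - x i * p) ^+ 2 + p ^+ 2 + s ^+ 2) / (w i ^+ 2 + x i ^+ 2 + 1)
  + c ^+ 2 * (w i ^+ 2 + x i ^+ 2 + 1)
    / (\sum_(j < N) m j * (w j ^+ 2 + x j ^+ 2 + 1)) ^+ 2.

(* As for [curved_nbody_solution], satisfying the system includes staying where
   its right-hand side makes sense, and the existence of every derivative that
   occurs in it. *)
Definition nh_system (R : realType) (N : nat) (m : 'I_N -> R) (I : set R)
    (c : R) (w x rho : 'I_N -> R -> R) (b : 'I_N -> R) (beta : R -> R) : Prop :=
  exists p s : 'I_N -> R -> R,
  forall t : R, I t -> forall i : 'I_N,
  let W := fun j : 'I_N => w j t in
  let X := fun j : 'I_N => x j t in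
  let d := fun j : 'I_N => (nh_q b W X i j ^+ 2 - 1) `^ (3 / 2) in
  [/\ w i t ^+ 2 + x i t ^+ 2 = rho i t ^+ 2 - 1,
      forall j : 'I_N, j != i -> 0 < nh_q b W X i j ^+ 2 - 1,
      is_derive t 1 (w i) (p i t) /\ is_derive t 1 (x i) (s i t),
      is_derive t 1 (p i)
        (\sum_(j < N | j != i) m j * (w j t + nh_q b W X i j * w i t) / d j
         + nh_K m c W X i (p i t) (s i t) * w i t) /\
      is_derive t 1 (s i)
        (\sum_(j < N | j != i) m j * (x j t + nh_q b W X i j * x i t) / d j
         + nh_K m c W X i (p i t) (s i t) * x i t) &
      [/\ derivable (rho i) t 1, derivable beta t 1, derivable beta^`() t 1 &
          rho i t * beta^`(2)%classic t
          + 2 * (rho i)^`()%classic t * beta^`()%classic t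
          = \sum_(j < N | j != i) m j * rho j t * sinh (b j - b i) / d j]].

(* Main.v *)
Require Import Defs.
From HB Require Import structures.
From mathcomp Require Import all_boot all_order all_algebra.
From mathcomp Require Import all_classical all_reals all_analysis.
From mathcomp Require Import ring lra.

Set Implicit Arguments.
Unset Strict Implicit.
Unset Printing Implicit Defensive.

Import Order.TTheory GRing.Theory Num.Theory.
Import numFieldNormedType.Exports.

Local Open Scope ring_scope.
Local Open Scope classical_set_scope.

(* In polar coordinates (rho_i, beta + b_i) of the (y, z)-plane, the y and z
   equations split into an angular one, the last equation of the system, and a
   radial one, which is redundant: it follows from the w and x equations by
   differentiating rho_i^2 = w_i^2 + x_i^2 + 1 twice.  Summing the angular
   equations against m_i rho_i, the forces cancel in pairs, so that
   c = (\sum_i m_i rho_i^2) beta' is conserved, and c = 0 would make beta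
   constant.  Given beta' = c / \sum_i m_i rho_i^2, the Lorentz square of the
   velocity of body i is K_i. *)

(** * Derivatives of real functions and of row vectors *)

(** The differentiation rules return values of a fixed shape; freeing the value leaves the passage
    to the desired shape as an identity for [ring] or [field]. *)
Lemma is_derive_ext (R : realType) (f g : R -> R) (t a c : R) :
  f =1 g -> a = c -> is_derive t 1 f a -> is_derive t 1 g c.
Proof. by move=> /funext -> ->. Qed.

Lemma is_derive_addf (R : realType) (f g : R -> R) (t a c : R) :
  is_derive t 1 f a -> is_derive t 1 g c ->
  is_derive t 1 (fun s => f s + g s) (a + c).
Proof. by move=> df dg; exact: is_deriveD. Qed.

Lemma is_derive_subf (R : realType) (f g : R -> R) (t a c : R) :
  is_derive t 1 f a -> is_derive t 1 g c ->
  is_derive t 1 (fun s => f s - g s) (a - c).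
Proof. by move=> df dg; exact: is_deriveB. Qed.

Lemma is_derive_cstf (R : realType) (t a : R) : is_derive t 1 (fun=> a) (0 : R).
Proof. exact: is_derive_cst. Qed.

Lemma is_derive_mulf (R : realType) (f g : R -> R) (t a c : R) :
  is_derive t 1 f a -> is_derive t 1 g c ->
  is_derive t 1 (fun s => f s * g s) (a * g t + f t * c).
Proof.
move=> df dg; have := is_deriveM df dg; apply: is_derive_ext => //.
by rewrite /GRing.scale/= addrC mulrC.
Qed.

Lemma is_derive_invf (R : realType) (f : R -> R) (t a : R) :
  f t != 0 -> is_derive t 1 f a ->
  is_derive t 1 (fun s => (f s)^-1) (- a / f t ^+ 2).
Proof.
move=> f0 df; have := is_deriveV f0 df; apply: is_derive_ext => //.
by rewrite /GRing.scale/= mulrC mulrN mulNr.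
Qed.

Lemma is_derive_compf (R : realType) (f g : R -> R) (t a c : R) :
  is_derive t 1 g c -> is_derive (g t) 1 f a ->
  is_derive t 1 (fun s => f (g s)) (a * c).
Proof. by move=> dg df; exact: is_derive1_comp. Qed.

Lemma is_derive1_unique (R : realType) (f : R -> R) (t a c : R) :
  is_derive t 1 f a -> is_derive t 1 f c -> a = c.
Proof. by move=> [_ <-] [_ <-]. Qed.

Lemma open_near (R : realType) (I : set R) (P : R -> Prop) (t : R) :
  open I -> I t -> (forall s, I s -> P s) -> \forall s \near t, P s.
Proof. by move=> Io It IP; apply: filterS IP _; exact: open_nbhs_nbhs. Qed.

(** Motions are constrained on [I] only. As [I] is open, agreement on [I] is agreement near [t], and
    this determines the derivative at [t]. *)
Lemma is_derive_open_ext (R : realType) (V : normedModType R) (I : set R)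
    (f g : R -> V) (t : R) (a : V) :
  open I -> I t -> (forall s, I s -> f s = g s) ->
  is_derive t 1 f a -> is_derive t 1 g a.
Proof. by move=> Io It fg; apply: near_eq_is_derive; exact: open_near fg. Qed.

Lemma is_derive_derive1 (R : realType) (V : normedModType R) (f : R -> V)
    (t : R) :
  derivable f t 1 -> is_derive t 1 f (f^`()%classic t).
Proof. by move=> /derivableP; rewrite derive1E. Qed.

Lemma is_derive_derive1E (R : realType) (V : normedModType R) (f : R -> V)
    (t : R) (a : V) :
  is_derive t 1 f a -> f^`()%classic t = a.
Proof. by rewrite derive1E => -[]. Qed.

(** Passes between the vector equation of motion and its scalar coordinates. *)
Lemma is_derive_rowP (R : realType) (n : nat) (f : R -> 'rV[R]_n) (t : R)
    (a : 'rV[R]_n) :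
  is_derive t 1 f a <-> forall k, is_derive t 1 (fun s => f s 0 k) (a 0 k).
Proof.
split=> [[df <-] k|df].
  rewrite derive_mx// mxE; apply: derivableP.
  exact: (derivable_mxP f t 1).1 df 0 k.
have fD : derivable f t 1.
  by apply/derivable_mxP => i k; rewrite ord1; case: (df k).
apply: DeriveDef => //; rewrite derive_mx//; apply/rowP => k.
by rewrite mxE; case: (df k).
Qed.

(** Mean value theorem on the segment between the two times, which stays in [I] because [I] is an
    interval. *)
Lemma derive0_constant_on (R : realType) (I : set R) (f : R -> R) :
  is_interval I -> (forall t, I t -> is_derive t 1 f 0) -> constant_on I f.
Proof.
move=> Ii df s t.
wlog st : s t / s <= t.
  move=> H Is It; case/orP: (le_total s t) => st; first exact: H.
  by apply/esym; exact: H.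
move=> Is It; have II u : s <= u <= t -> I u by exact: Ii.
have [u _] := @MVT_segment R f (fun=> 0) s t st
  (fun u (hu : u \in `]s, t[%R) => df u (II u (subset_itv_oo_cc hu)))
  (derivable_within_continuous
    (fun u (hu : u \in `[s, t]%R) => @ex_derive _ _ _ _ _ _ _ (df u (II u hu)))).
by rewrite mul0r => /eqP; rewrite subr_eq0 => /eqP.
Qed.

(** * Hyperbolic functions and polar coordinates of the (y, z)-plane *)

Lemma coshN (R : realType) (a : R) : cosh (- a) = cosh a.
Proof. by rewrite /cosh opprK addrC. Qed.

Lemma sinhN (R : realType) (a : R) : sinh (- a) = - sinh a.
Proof. by rewrite /sinh opprK -mulNr opprB. Qed.

Lemma cosh_sqr (R : realType) (a : R) : cosh a ^+ 2 = 1 + sinh a ^+ 2.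
Proof.
have h : expR a * expR (- a) = 1 by rewrite -expRD subrr expR0.
by apply/eqP; rewrite -subr_eq /cosh /sinh -[X in _ == X]h; apply/eqP; field.
Qed.

Lemma sinhB (R : realType) (a b : R) :
  sinh (a - b) = sinh a * cosh b - cosh a * sinh b.
Proof. by rewrite /sinh /cosh opprB !expRD; field. Qed.

Lemma coshB (R : realType) (a b : R) :
  cosh (a - b) = cosh a * cosh b - sinh a * sinh b.
Proof. by rewrite /sinh /cosh opprB !expRD; field. Qed.

Lemma cosh_gt0 (R : realType) (a : R) : 0 < cosh a.
Proof. by rewrite divr_gt0// addr_gt0// expR_gt0. Qed.

Lemma is_derive_expf (R : realType) (f : R -> R) (t a : R) :
  is_derive t 1 f a ->
  is_derive t 1 (fun s => expR (f s)) (expR (f t) * a).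
Proof. by move=> df; exact: is_derive1_comp. Qed.

Lemma is_derive_sinh_shift (R : realType) (f : R -> R) (b t a : R) :
  is_derive t 1 f a ->
  is_derive t 1 (fun s => sinh (f s + b)) (a * cosh (f t + b)).
Proof.
move=> df.
have dp : is_derive t 1 (fun s => f s + b) (a + 0).
  exact: is_derive_addf.
have dn : is_derive t 1 (fun s => - (f s + b)) (- (a + 0)) by exact: is_deriveN.
have := is_derive_mulf (is_derive_subf (is_derive_expf dp) (is_derive_expf dn))
  (is_derive_cstf t 2^-1).
by apply: is_derive_ext => //=; rewrite /cosh; field.
Qed.

Lemma is_derive_cosh_shift (R : realType) (f : R -> R) (b t a : R) :
  is_derive t 1 f a ->
  is_derive t 1 (fun s => cosh (f s + b)) (a * sinh (f t + b)).
Proof.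
move=> df.
have dp : is_derive t 1 (fun s => f s + b) (a + 0).
  exact: is_derive_addf.
have dn : is_derive t 1 (fun s => - (f s + b)) (- (a + 0)) by exact: is_deriveN.
have := is_derive_mulf (is_derive_addf (is_derive_expf dp) (is_derive_expf dn))
  (is_derive_cstf t 2^-1).
by apply: is_derive_ext => //=; rewrite /sinh; field.
Qed.

Lemma polar_derive (R : realType) (r f : R -> R) (b t r1 f1 : R) :
  is_derive t 1 r r1 -> is_derive t 1 f f1 ->
  is_derive t 1 (fun s => r s * sinh (f s + b))
    (r1 * sinh (f t + b) + r t * f1 * cosh (f t + b)) /\
  is_derive t 1 (fun s => r s * cosh (f s + b))
    (r1 * cosh (f t + b) + r t * f1 * sinh (f t + b)).
Proof.
move=> dr df; split.
  have := is_derive_mulf dr (is_derive_sinh_shift b df).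
  by apply: is_derive_ext => //; ring.
have := is_derive_mulf dr (is_derive_cosh_shift b df).
by apply: is_derive_ext => //; ring.
Qed.

(** In the frame (sinh, cosh), (cosh, sinh) the radial acceleration is r'' + r f'^2 and the
    transverse one is 2 r' f' + r f''. The plus sign, where circular motion has a minus, comes from
    sinh'' = sinh and cosh'' = cosh. *)
Lemma polar_derive2 (R : realType) (r f r1 f1 : R -> R) (b t r2 f2 : R) :
  is_derive t 1 r (r1 t) -> is_derive t 1 f (f1 t) ->
  is_derive t 1 r1 r2 -> is_derive t 1 f1 f2 ->
  is_derive t 1
    (fun s => r1 s * sinh (f s + b) + r s * f1 s * cosh (f s + b))
    ((r2 + r t * f1 t ^+ 2) * sinh (f t + b)
     + (2 * r1 t * f1 t + r t * f2) * cosh (f t + b)) /\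
  is_derive t 1
    (fun s => r1 s * cosh (f s + b) + r s * f1 s * sinh (f s + b))
    ((r2 + r t * f1 t ^+ 2) * cosh (f t + b)
     + (2 * r1 t * f1 t + r t * f2) * sinh (f t + b)).
Proof.
move=> dr df dr1 df1; have drf := is_derive_mulf dr df1.
(* Both terms of the velocity are again polar products, of radius [r1] and of radius [r * f1]. *)
have [s1 c1] := polar_derive b dr1 df.
have [s2 c2] := polar_derive b drf df.
split.
  have := is_derive_addf s1 c2; apply: is_derive_ext => //; ring.
have := is_derive_addf c1 s2; apply: is_derive_ext => //; ring.
Qed.

(** * Differentiability of the radius and of the angle *)

(** On [I] the constraint and the sign of [r] give r = sqrt(w^2 + x^2 + 1) with a positive radicand,
    so [r] inherits differentiability from [w] and [x]. *)
Lemma radius_derive (R : realType) (I : set R) (w x r p s : R -> R) :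
  open I ->
  (forall t, I t -> 0 < r t /\ w t ^+ 2 + x t ^+ 2 - r t ^+ 2 = -1) ->
  (forall t, I t -> is_derive t 1 w (p t) /\ is_derive t 1 x (s t)) ->
  forall t, I t -> is_derive t 1 r ((w t * p t + x t * s t) / r t).
Proof.
move=> Io hr dwx t It; have [dw dx] := dwx t It.
have r2 u : I u -> w u * w u + x u * x u + 1 = r u ^+ 2.
  by move=> Iu; have [_ h] := hr u Iu; lra.
have rt0 : 0 < r t by case: (hr t It).
have rn0 : r t != 0 by rewrite gt_eqF.
apply: (@is_derive_open_ext _ _ I (Num.sqrt \o fun u => w u * w u + x u * x u + 1)) => //.
  by move=> u Iu /=; rewrite r2// sqrtr_sqr gtr0_norm//; case: (hr u Iu).
have dq := is_derive_addf (is_derive_addf (is_derive_mulf dw dw)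
  (is_derive_mulf dx dx)) (is_derive_cstf t 1).
have q0 : 0 < w t * w t + x t * x t + 1 by rewrite r2// exprn_gt0.
have := is_derive_compf dq (is_derive1_sqrt q0).
apply: is_derive_ext => //=; rewrite r2// sqrtr_sqr gtr0_norm//.
by field.
Qed.

(** Since sinh + cosh = exp, the quotient (y + z) / r equals exp(f + b), and [f] is recovered as its
    logarithm minus [b]. *)
Lemma angle_derivable (R : realType) (I : set R) (r f : R -> R) (b u v r1 t : R) :
  open I -> I t -> (forall t, I t -> 0 < r t) ->
  is_derive t 1 (fun s => r s * sinh (f s + b)) u ->
  is_derive t 1 (fun s => r s * cosh (f s + b)) v ->
  is_derive t 1 r r1 -> derivable f t 1.
Proof.
move=> Io It r0 dy dz dr.
have rt0 : r t != 0 by rewrite gt_eqF// r0.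
have expE s : sinh (f s + b) + cosh (f s + b) = expR (f s + b).
  by rewrite /sinh /cosh; field.
have dq := is_derive_mulf (is_derive_addf dy dz) (is_derive_invf rt0 dr).
have qE s : I s -> (r s * sinh (f s + b) + r s * cosh (f s + b)) / r s = expR (f s + b).
  by move=> Is; have := r0 s Is; rewrite -mulrDr expE => ?;
    rewrite mulrAC divff ?mul1r// gt_eqF.
have q0 : 0 < (r t * sinh (f t + b) + r t * cosh (f t + b)) / r t.
  by rewrite qE// expR_gt0.
have dl := is_derive_subf (is_derive_compf dq (is_derive1_ln q0)) (is_derive_cstf t b).
apply: (@ex_derive _ _ _ _ _ _ _); apply: is_derive_open_ext Io It _ dl => s Is /=.
by rewrite qE// expRK addrK.
Qed.

(** Second derivatives are given for the Cartesian coordinates only. Solving for r' and f' expresses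
    them through functions already known to be differentiable, so they can be differentiated again.
    The last identity is the transverse component of the acceleration. *)
Lemma polar_kinematics (R : realType) (I : set R) (w x r f p s u v : R -> R)
    (b : R) (p2 s2 u2 v2 : R -> R) :
  open I ->
  (forall t, I t -> 0 < r t /\ w t ^+ 2 + x t ^+ 2 - r t ^+ 2 = -1) ->
  (forall t, I t -> is_derive t 1 w (p t) /\ is_derive t 1 x (s t)) ->
  (forall t, I t ->
     is_derive t 1 (fun s => r s * sinh (f s + b)) (u t) /\
     is_derive t 1 (fun s => r s * cosh (f s + b)) (v t)) ->
  (forall t, I t -> is_derive t 1 p (p2 t) /\ is_derive t 1 s (s2 t)) ->
  (forall t, I t -> is_derive t 1 u (u2 t) /\ is_derive t 1 v (v2 t)) ->
  forall t, I t ->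
  [/\ derivable r t 1 /\ derivable r^`() t 1,
      derivable f t 1 /\ derivable f^`() t 1,
      u t = r^`()%classic t * sinh (f t + b)
            + r t * f^`()%classic t * cosh (f t + b),
      v t = r^`()%classic t * cosh (f t + b)
            + r t * f^`()%classic t * sinh (f t + b) &
      r t * f^`(2)%classic t + 2 * r^`()%classic t * f^`()%classic t
      = u2 t * cosh (f t + b) - v2 t * sinh (f t + b)].
Proof.
move=> Io hr dwx dyz dps duv.
have r0 t : I t -> 0 < r t by case/hr.
have dr := radius_derive Io hr dwx.
have rE t : I t -> (w t * p t + x t * s t) / r t = r^`()%classic t.
  by move=> It; rewrite (is_derive_derive1E (dr t It)).
have rD t : I t -> derivable r t 1.
  by move=> It; have := dr t It => h; exact: ex_derive.
have fD t : I t -> derivable f t 1.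
  move=> It; have [dy dz] := dyz t It;
  exact: angle_derivable Io It r0 dy dz (dr t It).
have uvE t : I t ->
    u t = r^`()%classic t * sinh (f t + b)
      + r t * f^`()%classic t * cosh (f t + b) /\
    v t = r^`()%classic t * cosh (f t + b)
      + r t * f^`()%classic t * sinh (f t + b).
  move=> It; have [dy dz] := dyz t It.
  have [dy' dz'] := polar_derive b (is_derive_derive1 (rD t It))
    (is_derive_derive1 (fD t It)).
  by split; [exact: is_derive1_unique dy dy'|exact: is_derive1_unique dz dz'].
(* The velocity (u, v) is paired with (cosh, -sinh): as cosh^2 - sinh^2 = 1, the radial part drops
   out and r f' remains. *)
have fE t : I t -> (u t * cosh (f t + b) - v t * sinh (f t + b)) / r t
    = f^`()%classic t.
  move=> It; have [-> ->] := uvE t It; have rn0 : r t != 0 by rewrite gt_eqF ?r0.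
  apply: (mulIf rn0); rewrite mulfVK//.
  by have := cosh_sqr (f t + b) => h; ring: h.
have r1D t : I t -> derivable r^`() t 1.
  move=> It; have [dw dx] := dwx t It; have [dp ds] := dps t It.
  have rn0 : r t != 0 by rewrite gt_eqF ?r0.
  have := is_derive_mulf (is_derive_addf (is_derive_mulf dw dp)
    (is_derive_mulf dx ds)) (is_derive_invf rn0 (dr t It)).
  by move=> /(is_derive_open_ext Io It rE) h; exact: ex_derive.
have f1D t : I t -> derivable f^`() t 1.
  move=> It; have [du dv] := duv t It.
  have df := is_derive_derive1 (fD t It).
  have rn0 : r t != 0 by rewrite gt_eqF ?r0.
  have := is_derive_mulf (is_derive_subf
    (is_derive_mulf du (is_derive_cosh_shift b df))
    (is_derive_mulf dv (is_derive_sinh_shift b df))) (is_derive_invf rn0 (dr t It)).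
  by move=> /(is_derive_open_ext Io It fE) h; exact: ex_derive.
move=> t It; have [uE vE] := uvE t It; split=> //.
- by split; [exact: rD|exact: r1D].
- by split; [exact: fD|exact: f1D].
- have [du dv] := duv t It.
  have [du' dv'] := polar_derive2 b (is_derive_derive1 (rD t It))
    (is_derive_derive1 (fD t It)) (is_derive_derive1 (r1D t It))
    (is_derive_derive1 (f1D t It)).
  (* The acceleration is known twice, as given and in polar form; uniqueness of the derivative
     identifies the two. *)
  have u2E := is_derive1_unique du (is_derive_open_ext Io It
    (fun t It => esym (uvE t It).1) du').
  have v2E := is_derive1_unique dv (is_derive_open_ext Io It
    (fun t It => esym (uvE t It).2) dv').
  rewrite derive1nS derive1n1 u2E v2E.
  have := cosh_sqr (f t + b) => h; ring: h.
Qed.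

(** * Conservation of the angular momentum *)

Lemma is_derive_sumf (R : realType) (n : nat) (h : 'I_n -> R -> R) (a : 'I_n -> R)
    (t : R) :
  (forall i, is_derive t 1 (h i) (a i)) ->
  is_derive t 1 (fun s => \sum_(i < n) h i s) (\sum_(i < n) a i).
Proof.
move=> dh; have := is_derive_sum dh.
by apply: is_derive_ext => // s; rewrite fct_sumE.
Qed.

(** Exchanging the two summation indices turns the sum into its opposite. *)
Lemma sum_antisym (R : realType) (n : nat) (f : 'I_n -> 'I_n -> R) :
  (forall i j, f i j = - f j i) ->
  \sum_(i < n) \sum_(j < n | j != i) f i j = 0.
Proof.
move=> fA; set S := LHS; suff : S = - S by lra.
rewrite {1}/S (exchange_big_dep predT)//= -sumrN; apply: eq_bigr => i _.
by rewrite -sumrN; apply: eq_big => [j|j _]; [rewrite eq_sym|exact: fA].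
Qed.

(** The derivative is the sum over i of m_i rho_i times the left side of the angular equation, hence
    a double sum of pair terms. These are antisymmetric, because sinh is odd and the denominators
    [d] are symmetric in the two bodies. *)
Lemma angular_momentum_constant (R : realType) (N : nat) (m : 'I_N -> R)
    (I : set R) (rho : 'I_N -> R -> R) (b : 'I_N -> R) (beta : R -> R)
    (d : R -> 'I_N -> 'I_N -> R) :
  is_interval I -> (forall t i j, I t -> d t i j = d t j i) ->
  (forall t, I t -> derivable beta^`() t 1) ->
  (forall t i, I t -> derivable (rho i) t 1) ->
  (forall t i, I t ->
     rho i t * beta^`(2)%classic t
       + 2 * (rho i)^`()%classic t * beta^`()%classic t
     = \sum_(j < N | j != i) m j * rho j t * sinh (b j - b i) / d t i j) ->
  constant_on I
    (fun t => (\sum_(i < N) m i * rho i t ^+ 2) * beta^`()%classic t).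
Proof.
move=> Ii dC b2 r1 eqn; apply: derive0_constant_on Ii _ => t It.
have dr i := is_derive_derive1 (r1 t i It).
have db := is_derive_derive1 (b2 t It).
have := is_derive_mulf (is_derive_sumf (fun i => is_derive_mulf
  (is_derive_cstf t (m i)) (is_derive_mulf (dr i) (dr i)))) db.
apply: is_derive_ext => //; rewrite !mulr_suml -big_split/=.
rewrite -[RHS](@sum_antisym R N (fun i j =>
  m i * rho i t * (m j * rho j t * sinh (b j - b i) / d t i j))); last first.
  by move=> i j; rewrite -(opprB (b i)) sinhN (dC t i j It); ring.
apply: eq_bigr => i _; rewrite -mulr_sumr -eqn//.
by rewrite derive1nS derive1n1; ring.
Qed.

(** * Geometry of the negative hyperbolic form *)

(** Packed as nested pairs so that a single [rewrite] serves all four coordinates. *)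
Lemma nh_motionE (R : realType) (N : nat) (w x rho : 'I_N -> R -> R)
    (b : 'I_N -> R) (beta : R -> R) (i : 'I_N) (t : R) :
  let u := nh_motion w x rho b beta i t in
  (((u 0 0 = w i t) * (u 0 1 = x i t))%type *
   ((u 0 2 = (rho i t * sinh (beta t + b i))%R) *
    (u 0 3 = (rho i t * cosh (beta t + b i))%R))%type)%type.
Proof. by rewrite /= !mxE. Qed.

Lemma forall_ord4 (P : 'I_4 -> Prop) : P 0 -> P 1 -> P 2 -> P 3 -> forall k, P k.
Proof.
move=> P0 P1 P2 P3 [[|[|[|[|k]]]] hk] //.
- by rewrite (_ : Ordinal _ = 0)//; exact: val_inj.
- by rewrite (_ : Ordinal _ = 1)//; exact: val_inj.
- by rewrite (_ : Ordinal _ = 2)//; exact: val_inj.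
- by rewrite (_ : Ordinal _ = 3)//; exact: val_inj.
Qed.

(** The bound z_i >= 1 fixes the sign of rho_i, since cosh is positive. *)
Lemma nh_form_gt0 (R : realType) (N : nat) (I : set R) (w x rho : 'I_N -> R -> R)
    (b : 'I_N -> R) (beta : R -> R) :
  negative_hyperbolic_form I w x rho b beta ->
  forall t, I t -> forall i : 'I_N, 0 < rho i t.
Proof.
move=> [_ h] t It i; have [h1 _] := h t It i.
by rewrite -(pmulr_lgt0 _ (cosh_gt0 (beta t + b i))); exact: lt_le_trans h1.
Qed.

Lemma nh_form_sqr (R : realType) (N : nat) (I : set R) (w x rho : 'I_N -> R -> R)
    (b : 'I_N -> R) (beta : R -> R) :
  negative_hyperbolic_form I w x rho b beta ->
  forall t, I t -> forall i : 'I_N, w i t ^+ 2 + x i t ^+ 2 + 1 = rho i t ^+ 2.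
Proof. by move=> [_ h] t It i; have [_ ] := h t It i; lra. Qed.

(** As rho_i > 0, the square roots in [nh_q] are the radii themselves. *)
Lemma nh_qE (R : realType) (N : nat) (I : set R) (w x rho : 'I_N -> R -> R)
    (b : 'I_N -> R) (beta : R -> R) (t : R) (i j : 'I_N) :
  negative_hyperbolic_form I w x rho b beta -> I t ->
  nh_q b (w^~ t) (x^~ t) i j =
  w i t * w j t + x i t * x j t - rho i t * rho j t * cosh (b i - b j).
Proof.
move=> hf It; rewrite /nh_q !(nh_form_sqr hf It) !sqrtr_sqr.
by rewrite !gtr0_norm// (nh_form_gt0 hf It).
Qed.

(** The common angle [beta t] cancels by the addition formula for cosh. *)
Lemma lorentz_nh_motion (R : realType) (N : nat) (I : set R)
    (w x rho : 'I_N -> R -> R) (b : 'I_N -> R) (beta : R -> R) (t : R)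
    (i j : 'I_N) :
  negative_hyperbolic_form I w x rho b beta -> I t ->
  lorentz (nh_motion w x rho b beta i t) (nh_motion w x rho b beta j t) =
  nh_q b (w^~ t) (x^~ t) i j.
Proof.
move=> hf It; rewrite (nh_qE i j hf It) /lorentz !nh_motionE.
rewrite (_ : b i - b j = (beta t + b i) - (beta t + b j)); last by ring.
by rewrite coshB; ring.
Qed.

Lemma nh_motion_in_H3 (R : realType) (N : nat) (I : set R)
    (w x rho : 'I_N -> R -> R) (b : 'I_N -> R) (beta : R -> R) (t : R)
    (i : 'I_N) :
  negative_hyperbolic_form I w x rho b beta -> I t ->
  in_H3 (nh_motion w x rho b beta i t).
Proof.
move=> hf It; split.
  rewrite (lorentz_nh_motion i i hf It) (nh_qE i i hf It) subrr.
  have := nh_form_sqr hf It i.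
  by rewrite /cosh oppr0 expR0; nra.
by rewrite nh_motionE mulr_gt0 ?cosh_gt0// (nh_form_gt0 hf It).
Qed.

(** * Components of the force and the Lorentz square of the velocity *)

Lemma force_coord (R : realType) (n N : nat) (P : pred 'I_N) (a c : 'I_N -> R)
    (u : 'I_N -> 'rV[R]_n) (v : 'rV[R]_n) (k : R) (l : 'I_n) :
  (\sum_(j < N | P j) a j *: (u j + c j *: v) + k *: v) 0 l =
  \sum_(j < N | P j) a j * (u j 0 l + c j * v 0 l) + k * v 0 l.
Proof. by rewrite !mxE summxE; under eq_bigr do rewrite !mxE. Qed.

(** [G] and [T] are the radial and transverse components of the force on body i, in the frame at its
    own angle [th + b i]. The addition formulas, applied to differences of angles, make both
    independent of [th]. *)
Lemma force_polar (R : realType) (N : nat) (P : pred 'I_N) (a c r b : 'I_N -> R)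
    (th : R) (i : 'I_N) :
  let T := \sum_(j < N | P j) a j * (r j * sinh (b j - b i)) in
  let G := \sum_(j < N | P j) a j * (r j * cosh (b i - b j) + c j * r i) in
  \sum_(j < N | P j) a j * (r j * sinh (th + b j) + c j * (r i * sinh (th + b i)))
  = G * sinh (th + b i) + T * cosh (th + b i) /\
  \sum_(j < N | P j) a j * (r j * cosh (th + b j) + c j * (r i * cosh (th + b i)))
  = G * cosh (th + b i) + T * sinh (th + b i).
Proof.
move=> T G; rewrite /T /G !mulr_suml -!big_split/=.
have h := cosh_sqr (th + b i).
have h1 j : b j - b i = (th + b j) - (th + b i) by ring.
have h2 j : b i - b j = (th + b i) - (th + b j) by ring.
by split; apply: eq_bigr => j _; rewrite h1 h2 sinhB coshB; ring: h.
Qed.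

(** The force is tangent to the hyperboloid: q_j + q_ij q_i is Lorentz-orthogonal to q_i. Hence its
    (w, x) part, paired with the position, balances the radial part r_i G. This is what makes the
    radial equation redundant. *)
Lemma force_radial (R : realType) (N : nat) (P : pred 'I_N)
    (a c w x r b : 'I_N -> R) (i : 'I_N) :
  w i ^+ 2 + x i ^+ 2 + 1 = r i ^+ 2 ->
  (forall j, c j = w i * w j + x i * x j - r i * r j * cosh (b i - b j)) ->
  w i * \sum_(j < N | P j) a j * (w j + c j * w i)
  + x i * \sum_(j < N | P j) a j * (x j + c j * x i) =
  r i * \sum_(j < N | P j) a j * (r j * cosh (b i - b j) + c j * r i).
Proof.
move=> hr hc; rewrite !mulr_sumr -big_split/=; apply: eq_bigr => j _.
have h : w i ^+ 2 = r i ^+ 2 - x i ^+ 2 - 1 by rewrite -hr; ring.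
by rewrite hc; ring: h.
Qed.

(** The left side is p^2 + s^2 - r1^2 + r^2 f1^2. Lagrange's identity for (w s - x p)^2 + (w p + x
    s)^2 turns the first three terms into the first fraction of K_i, and f1 = c / S gives the
    second. *)
Lemma speed_eq (R : realType) (w x r p s r1 f1 c S sh ch : R) :
  ch ^+ 2 = 1 + sh ^+ 2 -> r != 0 ->
  w ^+ 2 + x ^+ 2 + 1 = r ^+ 2 -> r * r1 = w * p + x * s -> f1 = c / S ->
  p ^+ 2 + s ^+ 2 + (r1 * sh + r * f1 * ch) ^+ 2 - (r1 * ch + r * f1 * sh) ^+ 2 =
  ((w * s - x * p) ^+ 2 + p ^+ 2 + s ^+ 2) / (w ^+ 2 + x ^+ 2 + 1)
  + c ^+ 2 * (w ^+ 2 + x ^+ 2 + 1) / S ^+ 2.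
Proof.
move=> hc r0 hr h1 hf.
have -> : (w * s - x * p) ^+ 2 + p ^+ 2 + s ^+ 2 =
    r ^+ 2 * (p ^+ 2 + s ^+ 2 - r1 ^+ 2).
  by rewrite mulrBr -exprMn h1 -hr; ring.
rewrite hr [r ^+ 2 * _]mulrC mulfK ?expf_neq0// [_ * r ^+ 2 / _]mulrAC.
by rewrite -expr_div_n -hf; ring: hc.
Qed.

Lemma nh_mass_sum (R : realType) (N : nat) (m : 'I_N -> R) (I : set R)
    (w x rho : 'I_N -> R -> R) (b : 'I_N -> R) (beta : R -> R) (t : R) :
  negative_hyperbolic_form I w x rho b beta -> I t ->
  \sum_(j < N) m j * (w j t ^+ 2 + x j t ^+ 2 + 1) =
  \sum_(j < N) m j * rho j t ^+ 2.
Proof. by move=> hf It; apply: eq_bigr => j _; rewrite (nh_form_sqr hf It). Qed.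

(** * From the equations of motion to the reduced system *)

Lemma nh_solution_reduced (R : realType) (N : nat) (m : 'I_N -> R) (I : set R)
    (w x rho : 'I_N -> R -> R) (b : 'I_N -> R) (beta : R -> R) :
  (0 < N)%N -> (forall i : 'I_N, 0 < m i) -> open I -> is_interval I ->
  negative_hyperbolic_form I w x rho b beta ->
  curved_nbody_solution m I (nh_motion w x rho b beta) ->
  exists c : R,
    [/\ c != 0,
        forall t : R, I t ->
          is_derive t 1 beta (c / \sum_(j < N) m j * rho j t ^+ 2) &
        nh_system m I c w x rho b beta].
Proof.
move=> N0 m0 Io Ii hf hc.
set q := nh_motion w x rho b beta in hc.
have r0 t i : I t -> 0 < rho i t by move=> It; exact: nh_form_gt0 hf t It i.
have hr t i : I t -> w i t ^+ 2 + x i t ^+ 2 + 1 = rho i t ^+ 2.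
  by move=> It; exact: nh_form_sqr hf t It i.
pose V i k t := (q i)^`()%classic t 0 k.
have dq t i k : I t -> is_derive t 1 (fun s => q i s 0 k) (V i k t).
  move=> It; have [_ _ qD _] := hc t It i.
  exact: (is_derive_rowP _ _ _).1 (is_derive_derive1 qD) k.
pose Q t i j := nh_q b (w^~ t) (x^~ t) i j.
pose d t i j := (Q t i j ^+ 2 - 1) `^ (3 / 2).
(* Coordinate [k] of the prescribed acceleration, with the Lorentz products already written as
   [nh_q]. *)
pose A t i k := \sum_(j < N | j != i) m j / d t i j *
   (q j t 0 k + Q t i j * q i t 0 k)
   + lorentz ((q i)^`()%classic t) ((q i)^`()%classic t) * q i t 0 k.
have dV t i k : I t -> is_derive t 1 (V i k) (A t i k).
  move=> It; have [_ _ _] := hc t It i.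
  move=> /is_derive_rowP/(_ k); apply: is_derive_ext => //.
  rewrite force_coord /A; congr (_ + _); apply: eq_bigr => j _.
  by rewrite (lorentz_nh_motion i j hf It).
have dw t i : I t -> is_derive t 1 (w i) (V i 0 t).
  move=> It; have := dq t i 0 It.
  by apply: is_derive_ext => // s; rewrite /q nh_motionE.
have dx t i : I t -> is_derive t 1 (x i) (V i 1 t).
  move=> It; have := dq t i 1 It.
  by apply: is_derive_ext => // s; rewrite /q nh_motionE.
have dy t i : I t -> is_derive t 1 (fun s => rho i s * sinh (beta s + b i)) (V i 2 t).
  move=> It; have := dq t i 2 It.
  by apply: is_derive_ext => // s; rewrite /q nh_motionE.
have dz t i : I t -> is_derive t 1 (fun s => rho i s * cosh (beta s + b i)) (V i 3 t).
  move=> It; have := dq t i 3 It.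
  by apply: is_derive_ext => // s; rewrite /q nh_motionE.
have pos i t : I t -> 0 < rho i t /\ w i t ^+ 2 + x i t ^+ 2 - rho i t ^+ 2 = -1.
  by move=> It; have := hr t i It; split; [exact: r0|lra].
have kin i := polar_kinematics Io (pos i)
  (fun t It => conj (dw t i It) (dx t i It))
  (fun t It => conj (dy t i It) (dz t i It))
  (fun t It => conj (dV t i 0 It) (dV t i 1 It))
  (fun t It => conj (dV t i 2 It) (dV t i 3 It)).
have rad i := radius_derive Io (pos i) (fun t It => conj (dw t i It) (dx t i It)).
have ang t i : I t ->
    rho i t * beta^`(2)%classic t
      + 2 * (rho i)^`()%classic t * beta^`()%classic t
    = \sum_(j < N | j != i) m j * rho j t * sinh (b j - b i) / d t i j.
  (* In the transverse projection of the acceleration, the radial force and the multiple of q_i both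
     cancel, and only the torque term stays. *)
  move=> It; have [_ _ _ _ ->] := kin i t It.
  have h := cosh_sqr (beta t + b i).
  rewrite /A /q !nh_motionE.
  under [X in (X + _) * _ - _]eq_bigr do rewrite nh_motionE.
  under [X in _ - (X + _) * _]eq_bigr do rewrite nh_motionE.
  have [-> ->] := force_polar (fun j => j != i) (fun j => m j / d t i j) (Q t i)
    (rho^~ t) b (beta t) i.
  rewrite (_ : \sum_(j < N | j != i) m j * rho j t * sinh (b j - b i) / d t i j =
    \sum_(j < N | j != i) m j / d t i j * (rho j t * sinh (b j - b i))); last first.
    by apply: eq_bigr => j _; ring.
  by ring: h.
pose i0 := Ordinal N0.
have bD t : I t -> derivable beta t 1 by move=> It; have [_ []] := kin i0 t It.
have b2D t : I t -> derivable beta^`() t 1 by move=> It; have [_ []] := kin i0 t It.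
have rD t i : I t -> derivable (rho i) t 1 by move=> It; have [[]] := kin i t It.
have QC t i j : I t -> Q t i j = Q t j i.
  move=> It; rewrite /Q (nh_qE i j hf It) (nh_qE j i hf It) -(opprB (b i)) coshN.
  by ring.
have dC t i j : I t -> d t i j = d t j i by move=> It; rewrite /d QC.
have Lc := angular_momentum_constant Ii dC b2D rD (fun t i It => ang t i It).
have S0 t : I t -> 0 < \sum_(j < N) m j * rho j t ^+ 2.
  move=> It; rewrite (bigD1 i0)//= ltr_pwDl ?mulr_gt0 ?exprn_gt0 ?r0//.
  by apply: sumr_ge0 => j _; rewrite mulr_ge0 ?exprn_ge0 ?ltW ?r0.
(* On an empty [I] every function would be constant, against the assumption on [beta]. *)
have [t0 It0] : exists t, I t.
  apply/not_existsP => Ie; apply: hf.1 => s t Is; case: (Ie s Is).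
(* The value at [t0] of the conserved angular momentum. *)
pose c := (\sum_(j < N) m j * rho j t0 ^+ 2) * beta^`()%classic t0.
have b1 t : I t -> beta^`()%classic t = c / \sum_(j < N) m j * rho j t ^+ 2.
  by move=> It; rewrite /c (Lc t0 t It0 It) mulrC mulKf// gt_eqF ?S0.
have db t : I t -> is_derive t 1 beta (c / \sum_(j < N) m j * rho j t ^+ 2).
  by move=> It; rewrite -b1//; exact: is_derive_derive1 (bD t It).
exists c; split=> //.
  apply/eqP => c0; apply: hf.1; apply: derive0_constant_on => // t It.
  by have := db t It; rewrite c0 mul0r.
(* The momenta p_i and s_i are the first two entries of the velocity of body i. *)
exists (fun i => V i 0), (fun i => V i 1) => t It i W X D.
have lorE : lorentz ((q i)^`()%classic t) ((q i)^`()%classic t) =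
    nh_K m c W X i (V i 0 t) (V i 1 t).
  have [_ _ uE vE _] := kin i t It.
  rewrite /lorentz -/(V i 0 t) -/(V i 1 t) -/(V i 2 t) -/(V i 3 t) uE vE.
  rewrite /nh_K (nh_mass_sum m hf It) -!expr2.
  apply: speed_eq => //.
  - exact: cosh_sqr.
  - by rewrite gt_eqF ?r0.
  - exact: hr.
  - rewrite (is_derive_derive1E (rad i t It)) mulrC mulfVK//.
    by apply: lt0r_neq0; exact: r0.
  - exact: b1.
have forceE k (y : 'I_N -> R) : (forall j, q j t 0 k = y j) ->
    A t i k = \sum_(j < N | j != i) m j * (y j + nh_q b W X i j * y i) / D j
      + nh_K m c W X i (V i 0 t) (V i 1 t) * y i.
  move=> yE; rewrite /A lorE yE; congr (_ + _); apply: eq_bigr => j _.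
  by rewrite yE mulrAC.
split.
- by rewrite -hr// addrK.
- move=> j ji; have [_ /(_ j ji)] := hc t It i.
  by rewrite (lorentz_nh_motion i j hf It).
- by split; [exact: dw|exact: dx].
- rewrite -(forceE 0 W) -?(forceE 1 X).
  + by split; exact: dV.
  + by move=> j; rewrite /q nh_motionE.
  + by move=> j; rewrite /q nh_motionE.
- by split; [exact: rD|exact: bD|exact: b2D|exact: ang].
Qed.

(** * From the reduced system back to the equations of motion *)

Lemma nh_reduced_solution (R : realType) (N : nat) (m : 'I_N -> R) (I : set R)
    (c : R) (w x rho : 'I_N -> R -> R) (b : 'I_N -> R) (beta : R -> R) :
  open I -> negative_hyperbolic_form I w x rho b beta ->
  (forall t : R, I t ->
     is_derive t 1 beta (c / \sum_(j < N) m j * rho j t ^+ 2)) ->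
  nh_system m I c w x rho b beta ->
  curved_nbody_solution m I (nh_motion w x rho b beta).
Proof.
move=> Io hf db [p [s sys]].
set q := nh_motion w x rho b beta.
have r0 t i : I t -> 0 < rho i t by move=> It; exact: nh_form_gt0 hf t It i.
have hr t i : I t -> w i t ^+ 2 + x i t ^+ 2 + 1 = rho i t ^+ 2.
  by move=> It; exact: nh_form_sqr hf t It i.
have pos i t : I t -> 0 < rho i t /\ w i t ^+ 2 + x i t ^+ 2 - rho i t ^+ 2 = -1.
  by move=> It; have := hr t i It; split; [exact: r0|lra].
have dw t i : I t -> is_derive t 1 (w i) (p i t).
  by move=> It; have [_ _ []] := sys t It i.
have dx t i : I t -> is_derive t 1 (x i) (s i t).
  by move=> It; have [_ _ []] := sys t It i.
have rad i := radius_derive Io (pos i) (fun t It => conj (dw t i It) (dx t i It)).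
pose r1 i t := (w i t * p i t + x i t * s i t) / rho i t.
(* [u] and [v] are the y and z velocities in polar form, where [r1] is the radial velocity. *)
pose u i t := r1 i t * sinh (beta t + b i)
  + rho i t * beta^`()%classic t * cosh (beta t + b i).
pose v i t := r1 i t * cosh (beta t + b i)
  + rho i t * beta^`()%classic t * sinh (beta t + b i).
have db1 t : I t -> is_derive t 1 beta (beta^`()%classic t).
  by move=> It; apply: is_derive_derive1; have := db t It => h; exact: ex_derive.
have dq t i : I t -> is_derive t 1 (q i) (vec4 (p i t) (s i t) (u i t) (v i t)).
  move=> It; apply/is_derive_rowP.
  have [dy dz] := polar_derive (b i) (rad i t It) (db1 t It).
  apply: forall_ord4; rewrite mxE /=.
  - by have := dw t i It; apply: is_derive_ext => // z; rewrite /q nh_motionE.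
  - by have := dx t i It; apply: is_derive_ext => // z; rewrite /q nh_motionE.
  - by have := dy; apply: is_derive_ext => // z; rewrite /q nh_motionE.
  - by have := dz; apply: is_derive_ext => // z; rewrite /q nh_motionE.
move=> t It i.
have [_ hQ _ [dp ds] [_ _ b2D ang]] := sys t It i.
set W := fun j => w j t in hQ dp ds ang; set X := fun j => x j t in hQ dp ds ang.
set Q := nh_q b W X i in hQ dp ds ang.
set K := nh_K _ _ _ _ _ _ _ in dp ds.
have QE j : lorentz (q i t) (q j t) = Q j by exact: lorentz_nh_motion hf It.
have qD := dq t i It.
split.
- exact: nh_motion_in_H3 hf It.
- by move=> j ji; rewrite QE; exact: hQ.
- exact: ex_derive.
(* On [I] the velocity of body i is the explicit vector above, which is differentiated in its
   place. *)
apply: (is_derive_open_ext Io It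
  (fun z Iz => esym (is_derive_derive1E (dq z i Iz)))).

have rn0 : rho i t != 0 by rewrite gt_eqF ?r0.
have r1E : rho i t * r1 i t = w i t * p i t + x i t * s i t.
  by rewrite /r1 mulrC mulfVK.
have lorE : lorentz ((q i)^`()%classic t) ((q i)^`()%classic t) = K.
  rewrite (is_derive_derive1E qD) /lorentz !mxE/= /K /nh_K (nh_mass_sum m hf It).
  rewrite -!expr2; apply: speed_eq => //.
  - exact: cosh_sqr.
  - exact: hr.
  - exact: is_derive_derive1E (db t It).
pose a j := m j / (Q j ^+ 2 - 1) `^ (3 / 2).
pose P := fun j => j != i.
set p2 := (X in is_derive t 1 (p i) X) in dp.
set s2 := (X in is_derive t 1 (s i) X) in ds.
have p2E : p2 = \sum_(j < N | P j) a j * (W j + Q j * W i) + K * W i.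
  by congr (_ + _); apply: eq_bigr => j _; rewrite /a mulrAC.
have s2E : s2 = \sum_(j < N | P j) a j * (X j + Q j * X i) + K * X i.
  by congr (_ + _); apply: eq_bigr => j _; rewrite /a mulrAC.
pose G := \sum_(j < N | P j) a j * (rho j t * cosh (b i - b j) + Q j * rho i t).
pose T := \sum_(j < N | P j) a j * (rho j t * sinh (b j - b i)).
have angT : rho i t * beta^`()^`()%classic t
      + 2 * (rho i)^`()%classic t * beta^`()%classic t = T.
  transitivity (rho i t * beta^`(2)%classic t
    + 2 * (rho i)^`()%classic t * beta^`()%classic t).
    by rewrite derive1nS derive1n1.
  rewrite ang; apply: eq_bigr => j _.
  by rewrite /a; ring.
rewrite (is_derive_derive1E (rad i t It)) -/(r1 i t) in angT.
have radG := @force_radial R N P a Q W X (rho^~ t) b i (hr t i It)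
  (fun j => nh_qE i j hf It).
have dr1 := is_derive_mulf (is_derive_addf (is_derive_mulf (dw t i It) dp)
  (is_derive_mulf (dx t i It) ds)) (is_derive_invf rn0 (rad i t It)).
set r2 := (X in is_derive t 1 _ X) in dr1.
(* The derivative of r r1 = w p + x s, solved for r times the radial second derivative. *)
have r2E : rho i t * r2 = p i t ^+ 2 + s i t ^+ 2 + w i t * p2 + x i t * s2 - r1 i t ^+ 2.
  rewrite /r2 -r1E; rewrite -/(r1 i t); field. exact: rn0.
have KE : K = p i t ^+ 2 + s i t ^+ 2
    + (rho i t * beta^`()%classic t) ^+ 2 - r1 i t ^+ 2.
  rewrite -lorE (is_derive_derive1E qD) /lorentz !mxE/= /u /v.
  by have h := cosh_sqr (beta t + b i); ring: h.
(* Tangency of the force gives the term in [G], and w^2 + x^2 = rho^2 - 1 the term in [K]. *)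
have accE : w i t * p2 + x i t * s2 = rho i t * G + K * (rho i t ^+ 2 - 1).
  rewrite p2E s2E -(hr t i It) /G -radG /W /X; ring.
(* The radial equation: after multiplication by rho_i, the velocity terms add up to [K], which
   cancels the -K of [accE]. *)
have r2G : r2 + rho i t * beta^`()%classic t ^+ 2 = G + K * rho i t.
  apply: (mulfI rn0); rewrite mulrDr r2E -(addrA (p i t ^+ 2 + _)) accE.
  clear - KE; move: KE; set f1 := beta^`()%classic t => KE; lra.
(* Kinematics and force now share one frame; with radial part G + K rho_i and transverse part [T],
   the y and z equations agree. *)
have [dy dz] := polar_derive2 (b i) (rad i t It) (db1 t It) dr1
  (is_derive_derive1 b2D).
have [fy fz] := force_polar P a Q (rho^~ t) b (beta t) i.
rewrite -/(r1 i t) r2G [_ + rho i t * _]addrC angT in dy dz.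
have forceE k (y : 'I_N -> R) : (forall j, q j t 0 k = y j) ->
    \sum_(j < N | j != i)
      m j / (lorentz (q i t) (q j t) ^+ 2 - 1) `^ (3 / 2) *
      (q j t 0 k + lorentz (q i t) (q j t) * q i t 0 k) + K * q i t 0 k =
    \sum_(j < N | P j) a j * (y j + Q j * y i) + K * y i.
  by move=> yE; rewrite yE; congr (_ + _); apply: eq_bigr => j _; rewrite yE QE.
apply/is_derive_rowP; apply: forall_ord4; rewrite force_coord lorE.
- rewrite (forceE 0 W) -?p2E; last by move=> j; rewrite /q nh_motionE.
  by have := dp; apply: is_derive_ext => // z; rewrite mxE.
- rewrite (forceE 1 X) -?s2E; last by move=> j; rewrite /q nh_motionE.
  by have := ds; apply: is_derive_ext => // z; rewrite mxE.
- rewrite (forceE 2 (fun j => rho j t * sinh (beta t + b j))); last first.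
    by move=> j; rewrite /q nh_motionE.
  rewrite fy -/G -/T; have := dy; apply: is_derive_ext => [z|]; first by rewrite mxE.
  by ring.
- rewrite (forceE 3 (fun j => rho j t * cosh (beta t + b j))); last first.
    by move=> j; rewrite /q nh_motionE.
  rewrite fz -/G -/T; have := dz; apply: is_derive_ext => [z|]; first by rewrite mxE.
  by ring.
Qed.

(** * Rotopulsators, relative equilibria and singular configurations *)

Theorem mainTheorem6 (R : realType) (N : nat) (m : 'I_N -> R) (I : set R)
    (w x rho : 'I_N -> R -> R) (b : 'I_N -> R) (beta : R -> R)
    (hN : (2 <= N)%N) (hm : forall i : 'I_N, 0 < m i)
    (hIo : open I) (hIi : is_interval I)
    (hform : negative_hyperbolic_form I w x rho b beta) :
  let q := nh_motion w x rho b beta in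
  let qf := fun (i j : 'I_N) (t : R) =>
    nh_q b (fun k : 'I_N => w k t) (fun k : 'I_N => x k t) i j in
  let reduced := exists c : R,
    [/\ c != 0,
        forall t : R, I t ->
          is_derive t 1 beta (c / \sum_(j < N) m j * rho j t ^+ 2) &
        nh_system m I c w x rho b beta] in
  [/\ negative_hyperbolic_rotopulsator m I q <->
        reduced /\ exists i j : 'I_N, i != j /\ ~ constant_on I (qf i j),
      reduced -> (forall i j : 'I_N, i != j -> constant_on I (qf i j)) ->
        negative_hyperbolic_relative_equilibrium m I q &
      (exists (i j : 'I_N) (t : R),
         [/\ i != j, I t & qf i j t = 1 \/ qf i j t = -1]) ->
        ~ negative_hyperbolic_rotopulsator m I q /\
        ~ negative_hyperbolic_relative_equilibrium m I q].
Proof.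
move=> q qf reduced.
have qfE i j t : I t -> lorentz (q i t) (q j t) = qf i j t.
  exact: lorentz_nh_motion hform.
have constE i j : constant_on I (fun t => lorentz (q i t) (q j t)) <->
    constant_on I (qf i j).
  by split=> h s t Is It; have := h s t Is It; rewrite !qfE.
(* Rotopulsators and relative equilibria differ only in the condition on the q_ij, so this
   equivalence settles both. *)
have redP : reduced <-> curved_nbody_solution m I q.
  split=> [[c [_ db sys]]|]; first exact: nh_reduced_solution hIo hform db sys.
  by apply: nh_solution_reduced => //; exact: ltnW.
have solP : reduced <-> negative_hyperbolic_solution m I q.
  split=> [/redP qs|[/redP]//]; split=> //.
  by exists w, x, rho, b, beta.
(* A solution stays where q_ij^2 - 1 > 0, which q_ij = 1 and q_ij = -1 both violate. *)
have singular_free : (exists (i j : 'I_N) (t : R),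
    [/\ i != j, I t & qf i j t = 1 \/ qf i j t = -1]) ->
    ~ curved_nbody_solution m I q.
  move=> [i [j [t [ij It q1]]]] /(_ t It i)[_ /(_ j)].
  rewrite eq_sym => /(_ ij) + _ _; rewrite qfE//.
  by case: q1 => ->; rewrite ?sqrrN expr1n subrr ltxx.
split.
- split=> [[/solP r [i [j [ij nc]]]]|[/solP r [i [j [ij nc]]]]].
    by split=> //; exists i, j; split=> // /constE.
  by split=> //; exists i, j; split=> // /constE.
- by move=> /solP r qc; split=> // i j ij; apply/constE; exact: qc.
- by move=> /singular_free ns; split=> -[[/ns]].
Qed.
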